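(* Under the hypotheses and notation of Theorem 1 (convex loss $\ell$, Gaussian measurements, $\varepsilon\in[0,1/2]$, $m/n\to\delta>1$ with bounded minimizer set, and $(\mu,\alpha,\lambda)$ the unique solution of the system with $\mu\ne0$), assume in addition that $\ell$ is continuously differentiable, and set $\sigma_\ell:=\alpha/\mu$. Then $$\sigma_\ell^2\,\mathcal{I}(\sigma_\ell G+SY)\ \ge\ \frac1\delta.$$
   Context: The system is: $\mathbb{E}[YS\,\mathcal{M}'_{\ell,1}(\alpha G+\mu SY;\lambda)]=0$, $\lambda^2\delta\,\mathbb{E}[(\mathcal{M}'_{\ell,1}(\alpha G+\mu SY;\lambda))^2]=\alpha^2$, $\lambda\delta\,\mathbb{E}[G\,\mathcal{M}'_{\ell,1}(\alpha G+\mu SY;\lambda)]=\alpha$, where $\mathcal{M}_\ell(x;\lambda)=\min_v\frac{1}{2\lambda}(x-v)^2+\ell(v)$ is the Moreau envelope and $\mathcal{M}'_{\ell,1}$ its derivative in $x$; $G,S$ i.i.d. $\mathcal{N}(0,1)$, $Y=\mathrm{BSC}_\varepsilon(\mathrm{sign}(S))$, i.e. $Y=\mathrm{sign}(S)$ w.p. $1-\varepsilon$ and $-\mathrm{sign}(S)$ w.p. $\varepsilon$, independently. For a random variable $H$ with differentiable density $p_H$, its Fisher information is $\mathcal{I}(H)=\mathbb{E}[(p_H'(H)/p_H(H))^2]$. *)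

(* Defs.v *)
From Stdlib Require Import Reals Lra.
Open Scope R_scope.

Definition phi (x : R) : R := exp (- x ^ 2 / 2) / sqrt (2 * PI).

(* sign; the value at 0 is irrelevant (S = 0 has probability 0). *)
Definition sgn (x : R) : R := if Rlt_dec 0 x then 1 else -1.

Definition improper_int (f : R -> R) (L : R) : Prop :=
  forall eps, 0 < eps -> exists A, forall a b, A <= a -> A <= b ->
    exists pr : Riemann_integrable f (- a) b, Rabs (RiemannInt pr - L) < eps.

Definition double_int (F : R -> R -> R) (L : R) : Prop :=
  exists h : R -> R,
    (forall s, improper_int (fun g => F g s) (h s)) /\ improper_int h L.

(* E[f(G,S,Y)] = L, where G,S iid N(0,1), Y = BSC_eps(sign S) independent. *)
Definition expect_GSY (eps : R) (f : R -> R -> R -> R) (L : R) : Prop :=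
  double_int (fun g s => phi g * phi s *
     ((1 - eps) * f g s (sgn s) + eps * f g s (- sgn s))) L.

Definition convex_fun (l : R -> R) : Prop :=
  forall x y t, 0 <= t <= 1 ->
    l (t * x + (1 - t) * y) <= t * l x + (1 - t) * l y.

Definition cont_diff (l : R -> R) : Prop :=
  exists dl : R -> R, (forall x, derivable_pt_lim l x (dl x)) /\ continuity dl.

Definition is_moreau (l : R -> R) (lam x m : R) : Prop :=
  (exists v, m = (x - v) ^ 2 / (2 * lam) + l v) /\
  (forall v, m <= (x - v) ^ 2 / (2 * lam) + l v).

(* The system of Theorem 1, for Mp x lam = M'_{l,1}(x;lam). *)
Definition system (eps delta : R) (Mp : R -> R -> R) (mu alpha lam : R) : Prop :=
  expect_GSY eps (fun g s y => y * s * Mp (alpha * g + mu * s * y) lam) 0 /\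
  (exists E2, expect_GSY eps (fun g s y => (Mp (alpha * g + mu * s * y) lam) ^ 2) E2
      /\ lam ^ 2 * delta * E2 = alpha ^ 2) /\
  (exists E3, expect_GSY eps (fun g s y => g * Mp (alpha * g + mu * s * y) lam) E3
      /\ lam * delta * E3 = alpha).

Definition is_density_H (eps sigma : R) (p : R -> R) : Prop :=
  forall a b, a < b ->
    exists pr : Riemann_integrable p a b,
      expect_GSY eps (fun g s y =>
        if Rlt_dec a (sigma * g + s * y) then
          (if Rlt_dec (sigma * g + s * y) b then 1 else 0) else 0)
        (RiemannInt pr).

(* Fisher information I(H) = E[(p'(H)/p(H))^2] = int p'^2 / p. *)
Definition fisher_info (p dp : R -> R) (I : R) : Prop :=
  improper_int (fun h => (dp h) ^ 2 / p h) I.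

(* Main.v *)
Require Import Defs.
From Stdlib Require Import Reals Lra.
From Coquelicot Require Import Coquelicot.
Open Scope R_scope.

(** Write [sig = alpha / mu], [H = sig G + S Y] and [f h = Mp (mu h) lam], so that
    [Mp (alpha G + mu S Y) lam = f H].  The density [p] of [H] is a Gaussian convolution with
    [p' h = - E[G | H = h] p h / sig].  Fubini's theorem turns the second and third equations
    of the system into values of [int f^2 p] and [int f (- sig p')]; Cauchy-Schwarz for these
    two integrals and [sig^2 int p'^2 / p] is the claim.  Fubini applies because [f] is
    Lipschitz (proximal maps are nonexpansive), so that every integrand in the plane is
    dominated by a multiple of [1 / ((1 + h^2) (1 + s^2))]. *)

(** * Improper integrals *)

(** Expectations are iterated improper Riemann integrals, so every interchange of limits needs an
    explicit error estimate. The comparison function [C / (1 + x ^ 2)] is chosen because its tails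
    are known exactly through [atan]. Three obstacles shape the rest. The factor [sgn s] jumps at 0,
    whereas Fubini is proved for continuous integrands; since [s * sgn s = Rabs s], symmetry of
    [phi] lets the law of [S Y] be written with [Rabs s] alone. The density is given only through
    probabilities of intervals and must first be identified with the convolution. Finally, the
    Fisher integral has to be shown to converge; it is dominated by the conditional second moment of
    [G]. Hence the weight [psi] on [G] takes the values 1, [g] and [g ^ 2], all bounded by
    [1 + g ^ 2]. *)

Lemma improper_intE (f : R -> R) (L : R) :
  improper_int f L <->
  forall eps, 0 < eps -> exists A, forall a b, A <= a -> A <= b ->
    ex_RInt f (- a) b /\ Rabs (RInt f (- a) b - L) < eps.
Proof.
split; intros H eps He; destruct (H eps He) as [A HA]; exists A; intros a b Ha Hb.
- destruct (HA a b Ha Hb) as [pr Hpr].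
  split; [exact (ex_RInt_Reals_1 _ _ _ pr)|].
  now rewrite (RInt_Reals _ _ _ pr).
- destruct (HA a b Ha Hb) as [Hex Hlt].
  exists (ex_RInt_Reals_0 _ _ _ Hex).
  now rewrite <- RInt_Reals.
Qed.

(* Meaningful only if the improper integral converges: otherwise a principal value or junk. *)
Definition RInt_line (f : R -> R) : R :=
  real (Lim_seq (fun n => RInt f (- INR n) (INR n))).

Lemma RInt_line_unique (f : R -> R) (L : R) : improper_int f L -> RInt_line f = L.
Proof.
intros H; unfold RInt_line.
rewrite (is_lim_seq_unique _ L); [easy|].
apply is_lim_seq_spec; intros eps.
destruct (proj1 (improper_intE f L) H eps (cond_pos eps)) as [A HA].
destruct (INR_unbounded A) as [N HN].
exists N; intros n Hn.
apply le_INR in Hn; apply HA; lra.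
Qed.

Lemma improper_int_ext (f g : R -> R) (L : R) :
  (forall x, f x = g x) -> improper_int f L -> improper_int g L.
Proof.
intros E H; apply improper_intE; intros eps He.
destruct (proj1 (improper_intE f L) H eps He) as [A HA].
exists A; intros a b Ha Hb; destruct (HA a b Ha Hb) as [H1 H2].
split; [now apply (ex_RInt_ext f)|].
now rewrite <- (RInt_ext f g) by auto.
Qed.

Lemma improper_int_lin (f g : R -> R) (Lf Lg c d : R) :
  improper_int f Lf -> improper_int g Lg ->
  improper_int (fun x => c * f x + d * g x) (c * Lf + d * Lg).
Proof.
intros Hf Hg; apply improper_intE; intros eps He.
pose proof (Rabs_pos c) as Pc; pose proof (Rabs_pos d) as Pd.
set (e := eps / (Rabs c + Rabs d + 1)).
assert (He' : 0 < e) by (apply Rdiv_lt_0_compat; lra).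
destruct (proj1 (improper_intE f Lf) Hf e He') as [A HA].
destruct (proj1 (improper_intE g Lg) Hg e He') as [B HB].
exists (Rmax A B); intros a b Ha Hb.
pose proof (Rmax_l A B); pose proof (Rmax_r A B).
destruct (HA a b) as [F1 F2]; [lra..|].
destruct (HB a b) as [G1 G2]; [lra..|].
assert (EI : is_RInt (fun x => c * f x + d * g x) (- a) b
               (c * RInt f (- a) b + d * RInt g (- a) b)).
{ apply (is_RInt_plus (V := R_NormedModule) (fun x => c * f x) (fun x => d * g x));
    apply (is_RInt_scal (V := R_NormedModule)); now apply (RInt_correct (V := R_CompleteNormedModule)). }
split; [eexists; exact EI|].
rewrite (is_RInt_unique _ _ _ _ EI).
replace (_ - _) with (c * (RInt f (- a) b - Lf) + d * (RInt g (- a) b - Lg)) by ring.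
eapply Rle_lt_trans; [apply Rabs_triang|].
rewrite !Rabs_mult.
assert (Rabs c * Rabs (RInt f (- a) b - Lf) <= Rabs c * e) by (apply Rmult_le_compat_l; lra).
assert (Rabs d * Rabs (RInt g (- a) b - Lg) <= Rabs d * e) by (apply Rmult_le_compat_l; lra).
assert (eps = (Rabs c + Rabs d + 1) * e) by (unfold e; field; lra).
lra.
Qed.

Lemma improper_int_ge0 (f : R -> R) (L : R) :
  (forall x, 0 <= f x) -> improper_int f L -> 0 <= L.
Proof.
intros P H; apply Rnot_lt_le; intros HL.
destruct (proj1 (improper_intE f L) H (- L)) as [A HA]; [lra|].
pose proof (Rmax_l A 0); pose proof (Rmax_r A 0).
destruct (HA (Rmax A 0) (Rmax A 0)) as [HE HR]; [lra..|].
assert (0 <= RInt f (- Rmax A 0) (Rmax A 0)) by (apply RInt_ge_0; auto; lra).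
apply Rabs_lt_between in HR; lra.
Qed.

Lemma cont_ex_RInt (f : R -> R) :
  (forall x, continuous f x) -> forall a b, ex_RInt f a b.
Proof. intros H a b; apply (ex_RInt_continuous (V := R_CompleteNormedModule)); auto. Qed.

Lemma cont_RInt_Chasles (f : R -> R) (a b c : R) :
  (forall x, continuous f x) -> RInt f a b + RInt f b c = RInt f a c :> R.
Proof.
intros H; apply (RInt_Chasles (V := R_CompleteNormedModule)); now apply cont_ex_RInt.
Qed.

Lemma cont_RInt_opp (f : R -> R) (a b : R) :
  (forall x, continuous f x) -> RInt f (- a) (- b) = - RInt (fun x => f (- x)) a b :> R.
Proof.
intros H.
pose proof (is_RInt_comp_opp (V := R_NormedModule) f a b _
  (RInt_correct (V := R_CompleteNormedModule) _ _ _ (cont_ex_RInt f H _ _))) as E.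
apply (is_RInt_opp (V := R_NormedModule)) in E.
apply (is_RInt_ext (V := R_NormedModule) _ (fun x => f (- x))) in E.
- rewrite (is_RInt_unique _ _ _ _ E); symmetry; apply Ropp_involutive.
- intros x _; apply Ropp_involutive.
Qed.

Lemma is_RInt_inv_1_sqr (C a b : R) :
  is_RInt (fun x => C * / (1 + x ^ 2)) a b (C * (atan b - atan a)).
Proof.
apply (is_RInt_scal (V := R_NormedModule) (fun x => / (1 + x ^ 2))).
apply (is_RInt_derive (V := R_CompleteNormedModule) atan).
- intros x _; apply is_derive_Reals, derivable_pt_lim_atan.
- intros x _; apply (ex_derive_continuous (V := R_NormedModule)).
  auto_derive; nra.
Qed.

Lemma dominated_RInt (f : R -> R) (C a b : R) :
  (forall x, continuous f x) -> (forall x, Rabs (f x) <= C * / (1 + x ^ 2)) ->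
  a <= b -> Rabs (RInt f a b) <= C * (atan b - atan a).
Proof.
intros Hc Hd Hab.
apply (norm_RInt_le (V := R_NormedModule) f (fun x => C * / (1 + x ^ 2)) a b); auto.
- now apply (RInt_correct (V := R_CompleteNormedModule)), cont_ex_RInt.
- apply is_RInt_inv_1_sqr.
Qed.

Lemma atan_tail (eps : R) : 0 < eps ->
  exists A, forall b, A <= b -> PI / 2 - atan b < eps.
Proof.
intros He.
pose proof PI_RGT_0.
set (t := Rmax 0 (PI / 2 - eps / 2)).
assert (0 <= t < PI / 2) by (unfold t, Rmax; destruct Rle_dec; lra).
assert (PI / 2 - eps < t) by (unfold t, Rmax; destruct Rle_dec; lra).
exists (tan t); intros b Hb.
assert (atan (tan t) <= atan b).
{ destruct Hb as [Hb| ->]; [left; now apply atan_increasing|lra]. }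
rewrite atan_tan in H2; lra.
Qed.

(** The Cauchy criterion, with the remainder of the arctangent integral as modulus. Keeping the
    rate, not just convergence, gives the later estimates that are uniform in a parameter; [b] may
    be negative. *)
Lemma dominated_half_line (f : R -> R) (C : R) :
  (forall x, continuous f x) -> (forall x, Rabs (f x) <= C * / (1 + x ^ 2)) ->
  exists L, forall b, Rabs (RInt f 0 b - L) <= C * (PI / 2 - atan b).
Proof.
intros Hc Hd.
assert (C0 : 0 <= C).
{ specialize (Hd 0); pose proof (Rabs_pos (f 0)).
  replace (C * / (1 + 0 ^ 2)) with C in Hd by field; lra. }
assert (Hinc : forall x y, x <= y ->
  Rabs (RInt f 0 y - RInt f 0 x) <= C * (PI / 2 - atan x)).
{ intros x y Hxy.
  rewrite <- (cont_RInt_Chasles f 0 x y Hc).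
  rewrite Rplus_minus_l.
  eapply Rle_trans; [now apply dominated_RInt with (C := C)|].
  pose proof (atan_bound y); apply Rmult_le_compat_l; lra. }
assert (Hlim : forall eps, 0 < eps -> exists A, forall b, A <= b ->
  C * (PI / 2 - atan b) < eps).
{ intros eps He.
  destruct (atan_tail (eps / (C + 1))) as [A HA].
  - apply Rdiv_lt_0_compat; lra.
  - exists A; intros b Hb; specialize (HA b Hb).
    pose proof (atan_bound b).
    assert (eps = (C + 1) * (eps / (C + 1))) by (field; lra).
    nra. }
(* The limit is taken along integers only; [Hinc] then carries it over to every real [b]. *)
destruct (Rcomplete.R_complete (fun n : nat => RInt f 0 (INR n))) as [L HL].
{ intros eps He.
  destruct (Hlim (eps / 2)) as [A HA]; [lra|].
  destruct (INR_unbounded A) as [N HN].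
  exists N; intros n m Hn Hm; unfold Rdist.
  apply le_INR in Hn; apply le_INR in Hm.
  pose proof (Hinc _ _ Hn) as H1; pose proof (Hinc _ _ Hm) as H2.
  assert (C * (PI / 2 - atan (INR N)) < eps / 2) by (apply HA; lra).
  apply Rabs_le_between in H1; apply Rabs_le_between in H2.
  apply Rabs_lt_between; lra. }
exists L; intros b.
apply le_epsilon; intros eps He.
destruct (HL eps He) as [N HN].
destruct (INR_unbounded b) as [M HM].
specialize (HN (Nat.max N M) (Nat.le_max_l _ _)); unfold Rdist in HN.
pose proof (le_INR _ _ (Nat.le_max_r N M)).
assert (Hb : b <= INR (Nat.max N M)) by lra.
specialize (Hinc _ _ Hb).
apply Rabs_le_between in Hinc; apply Rabs_lt_between in HN.
apply Rabs_le_between; lra.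
Qed.

Lemma tail_small (C eps : R) : 0 < eps ->
  exists A, forall a b, A <= a -> A <= b -> C * (PI - atan a - atan b) < eps.
Proof.
intros He.
pose proof (Rabs_pos C).
destruct (atan_tail (eps / (2 * (Rabs C + 1)))) as [A HA].
{ apply Rdiv_lt_0_compat; lra. }
exists A; intros a b Ha Hb.
apply HA in Ha; apply HA in Hb.
pose proof (atan_bound a); pose proof (atan_bound b).
assert (eps = 2 * (Rabs C + 1) * (eps / (2 * (Rabs C + 1)))) by (field; lra).
pose proof (Rle_abs C).
set (e := eps / _) in *.
assert (C * (PI - atan a - atan b) <= Rabs C * (PI - atan a - atan b))
  by (apply Rmult_le_compat_r; lra).
assert (Rabs C * (PI - atan a - atan b) <= Rabs C * (2 * e))
  by (apply Rmult_le_compat_l; lra).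
lra.
Qed.

Lemma improper_int_tail (f : R -> R) (C L : R) :
  (forall a b, ex_RInt f a b) ->
  (forall a b, 0 <= a -> 0 <= b ->
    Rabs (RInt f (- a) b - L) <= C * (PI - atan a - atan b)) ->
  improper_int f L.
Proof.
intros Hex Ht; apply improper_intE; intros eps He.
destruct (tail_small C eps He) as [A HA].
pose proof (Rmax_l A 0); pose proof (Rmax_r A 0).
exists (Rmax A 0); intros a b Ha Hb; split; [apply Hex|].
eapply Rle_lt_trans; [apply Ht|apply HA]; lra.
Qed.

Lemma dominated_RInt_line (f : R -> R) (C : R) :
  (forall x, continuous f x) -> (forall x, Rabs (f x) <= C * / (1 + x ^ 2)) ->
  improper_int f (RInt_line f) /\
  (forall a b, Rabs (RInt f (- a) b - RInt_line f) <= C * (PI - atan a - atan b)).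
Proof.
intros Hc Hd.
destruct (dominated_half_line f C Hc Hd) as [Lp Hp].
assert (Hc' : forall x, continuous (fun x => f (- x)) x).
{ intros x; apply (continuous_comp (fun x => - x) f); auto.
  apply (continuous_opp (V := R_NormedModule)), continuous_id. }
destruct (dominated_half_line (fun x => f (- x)) C Hc') as [Lm Hm].
{ intros x; replace (x ^ 2) with ((- x) ^ 2) by ring; auto. }
assert (Ht : forall a b, Rabs (RInt f (- a) b - (Lp + Lm)) <= C * (PI - atan a - atan b)).
{ intros a b.
  rewrite <- (cont_RInt_Chasles f (- a) 0 b Hc).
  assert (E2 := cont_RInt_Chasles f 0 (- a) 0 Hc).
  rewrite RInt_point in E2; unfold zero in E2; simpl in E2.
  assert (E3 := cont_RInt_opp f 0 a Hc); rewrite Ropp_0 in E3.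
  specialize (Hp b); specialize (Hm a).
  apply Rabs_le_between in Hp; apply Rabs_le_between in Hm.
  apply Rabs_le_between; lra. }
assert (HI : improper_int f (Lp + Lm)).
{ apply improper_int_tail with C; auto; now apply cont_ex_RInt. }
now rewrite (RInt_line_unique _ _ HI).
Qed.

Lemma dominated_RInt_line_bound (f : R -> R) (C : R) :
  (forall x, continuous f x) -> (forall x, Rabs (f x) <= C * / (1 + x ^ 2)) ->
  Rabs (RInt_line f) <= C * PI.
Proof.
intros Hc Hd.
destruct (dominated_RInt_line f C Hc Hd) as [_ H].
(* The tail estimate for the empty interval bounds the whole integral. *)
specialize (H 0 0).
rewrite Ropp_0, atan_0, RInt_point in H.
unfold zero in H; simpl in H.
rewrite <- Rabs_Ropp; replace (- RInt_line f) with (0 - RInt_line f) by ring.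
now replace (C * PI) with (C * (PI - 0 - 0)) by ring.
Qed.

(** * Fubini's theorem for dominated continuous functions *)

Definition cont2 (F : R -> R -> R) : Prop :=
  forall z : R * R, continuous (fun z => F (fst z) (snd z)) z.

Lemma cont2_pt (F : R -> R -> R) (x y : R) : cont2 F -> continuity_2d_pt F x y.
Proof. intros H; apply continuity_2d_pt_filterlim, (H (x, y)). Qed.

Lemma cont2_swap (F : R -> R -> R) : cont2 F -> cont2 (fun x y => F y x).
Proof.
intros H z.
apply (continuous_comp_2 (fun z : R * R => snd z) (fun z : R * R => fst z) F).
- apply continuous_snd.
- apply continuous_fst.
- apply H.
Qed.

Lemma cont2_r (F : R -> R -> R) (x : R) : cont2 F -> forall y, continuous (F x) y.
Proof.
intros H y; apply (continuous_comp_2 (fun _ => x) (fun y : R => y) F).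
- apply continuous_const.
- apply continuous_id.
- apply H.
Qed.

Lemma cont2_l (F : R -> R -> R) (y : R) : cont2 F -> forall x, continuous (fun x => F x y) x.
Proof. intros H; exact (cont2_r _ y (cont2_swap _ H)). Qed.

Lemma RInt_abs_le_const (f : R -> R) (a b M : R) :
  a <= b -> ex_RInt f a b -> (forall x, Rabs (f x) <= M) ->
  Rabs (RInt f a b) <= (b - a) * M.
Proof.
intros Hab Hf HM.
apply (norm_RInt_le_const (V := R_NormedModule) f a b); auto.
now apply (RInt_correct (V := R_CompleteNormedModule)).
Qed.

Lemma RInt_sub (f g : R -> R) (a b : R) : ex_RInt f a b -> ex_RInt g a b ->
  RInt (fun x => f x - g x) a b = RInt f a b - RInt g a b :> R.
Proof. apply (RInt_minus (V := R_CompleteNormedModule)). Qed.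

Lemma RInt_point_0 (f : R -> R) (a : R) : RInt f a a = 0 :> R.
Proof. apply (RInt_point (V := R_CompleteNormedModule)). Qed.

Lemma RInt_zero (f : R -> R) (a b : R) : (forall x, f x = 0) -> RInt f a b = 0 :> R.
Proof.
intros H; rewrite (RInt_ext f (fun _ => 0)) by auto.
rewrite RInt_const; apply Rmult_0_r.
Qed.

Lemma cont2_RInt (F : R -> R -> R) (c d : R) : c <= d -> cont2 F ->
  forall x, continuous (fun x => RInt (F x) c d) x.
Proof.
intros Hcd HF x; apply filterlim_locally; intros eps.
assert (He : 0 < eps / (d - c + 1)) by (apply Rdiv_lt_0_compat; [apply cond_pos|lra]).
(* The variable ranging over the compact interval must come first, hence the transposed [F]. The
   [+ 1] in the tolerance covers [c = d]. *)
destruct (uniform_continuity_2d_1d (fun s h => F h s) c d x) with (eps := mkposreal _ He)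
  as [del Hdel].
{ intros s _; apply (cont2_pt _ _ _ (cont2_swap _ HF)). }
exists del; intros y Hy.
change (Rabs (y - x) < del) in Hy.
change (Rabs (RInt (F y) c d - RInt (F x) c d) < eps).
rewrite <- RInt_sub by (apply cont_ex_RInt, cont2_r, HF).
eapply Rle_lt_trans.
- apply (norm_RInt_le_const (V := R_NormedModule) (fun s => F y s - F x s) c d _
    (eps / (d - c + 1))); auto.
  + intros s Hs; left; apply Rabs_lt_between in Hy.
    apply (Hdel s x s y); auto; try (destruct del; simpl in *; lra).
    rewrite Rminus_diag, Rabs_R0; apply cond_pos.
  + apply (RInt_correct (V := R_CompleteNormedModule)), cont_ex_RInt.
    intros s; apply (continuous_minus (V := R_NormedModule)); now apply cont2_r.
- assert (pos eps = (d - c + 1) * (eps / (d - c + 1))) by (field; lra).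
  lra.
Qed.

(** As functions of the upper limit [t], both iterated integrals vanish at [a] and have the
    derivative [RInt (F t) c d], so their difference [Psi] is constant. *)
Lemma RInt_RInt_swap (F : R -> R -> R) (a b c d : R) : a <= b -> c <= d -> cont2 F ->
  RInt (fun x => RInt (F x) c d) a b = RInt (fun y => RInt (fun x => F x y) a b) c d :> R.
Proof.
intros [Hab| <-] Hcd HF; cycle 1.
{ rewrite RInt_point_0, RInt_zero; [easy|intros; apply RInt_point_0]. }
set (Psi := fun t => RInt (fun x => RInt (F x) c d) a t -
                     RInt (fun y => RInt (fun x => F x y) a t) c d).
assert (HD : forall y u, is_derive (fun u => RInt (fun x => F x y) a u) u (F u y)).
{ intros y u; apply (is_derive_RInt (V := R_NormedModule) (fun x => F x y) _ a).
  - apply filter_forall; intros v.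
    apply (RInt_correct (V := R_CompleteNormedModule)), cont_ex_RInt; now apply cont2_l.
  - now apply cont2_l. }
assert (HP : forall t, is_derive Psi t 0).
{ intros t; replace 0 with (RInt (F t) c d - RInt (F t) c d) by apply Rminus_diag.
  apply (is_derive_minus (V := R_NormedModule)).
  - apply (is_derive_RInt (V := R_NormedModule) (fun x => RInt (F x) c d) _ a).
    + apply filter_forall; intros v.
      apply (RInt_correct (V := R_CompleteNormedModule)), cont_ex_RInt.
      now apply cont2_RInt.
    + now apply cont2_RInt.
  (* The integrand is written as a partial derivative, the form in which differentiation under the
     integral sign produces it. *)
  - rewrite (RInt_ext (F t) (fun y => Derive (fun u => RInt (fun x => F x y) a u) t))
      by (intros; symmetry; now apply is_derive_unique).
    apply (is_derive_RInt_param (fun u y => RInt (fun x => F x y) a u)).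
    + apply filter_forall; intros u y _; eexists; apply HD.
    + intros y _; apply (continuity_2d_pt_ext F); [|now apply cont2_pt].
      intros; symmetry; now apply is_derive_unique.
    + assert (Hloc : forall u, a <= u -> ex_RInt (fun y => RInt (fun x => F x y) a u) c d).
      { intros u Hu; apply cont_ex_RInt, (cont2_RInt (fun y x => F x y)); auto.
        now apply cont2_swap. }
      apply filter_forall; intros u.
      (* Integrability is needed for [u < a] too, where [cont2_RInt] applies only after exchanging
         the bounds. *)
      destruct (Rle_dec a u) as [Hu|Hu]; [now apply Hloc|].
      apply cont_ex_RInt; intros y.
      apply (continuous_ext (fun y => opp (RInt (fun x => F x y) u a))).
      * intros v; apply (opp_RInt_swap (V := R_CompleteNormedModule)), cont_ex_RInt.
        now apply cont2_l.
      * apply (continuous_opp (V := R_NormedModule)).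
        apply (cont2_RInt (fun y x => F x y)); [lra|now apply cont2_swap]. }
assert (E : Psi a = Psi b).
{ apply (eq_is_derive (V := R_NormedModule)); auto. }
assert (E0 : Psi a = 0).
{ unfold Psi; rewrite RInt_point_0, RInt_zero; [apply Rminus_0_r|].
  intros; apply RInt_point_0. }
rewrite E0 in E; unfold Psi in E; symmetry in E; now apply Rminus_diag_uniq in E.
Qed.


(** A uniform limit of continuous functions: the bound does not depend on [x], so the truncations to
    [[-A, A]] converge uniformly. *)
Lemma strip_RInt_line_cont (F : R -> R -> R) (C : R) : cont2 F ->
  (forall x y, Rabs (F x y) <= C * / (1 + y ^ 2)) ->
  forall x, continuous (fun x => RInt_line (F x)) x.
Proof.
intros HF Hd x; apply filterlim_locally; intros eps.
destruct (tail_small C (eps / 3)) as [A0 HA].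
{ apply Rdiv_lt_0_compat; [apply cond_pos|lra]. }
set (A := Rmax A0 0).
assert (A0 <= A /\ 0 <= A) as [HA0 HA1] by (split; [apply Rmax_l|apply Rmax_r]).
specialize (HA A A HA0 HA0).
assert (HT : forall x, Rabs (RInt (F x) (- A) A - RInt_line (F x)) < eps / 3).
{ intros u; destruct (dominated_RInt_line (F u) C) as [_ H]; auto.
  - now apply cont2_r.
  - eapply Rle_lt_trans; [apply H|easy]. }
assert (HC := cont2_RInt F (- A) A ltac:(lra) HF x).
assert (He : 0 < eps / 3) by (apply Rdiv_lt_0_compat; [apply cond_pos|lra]).
apply filterlim_locally with (eps := mkposreal _ He) in HC.
revert HC; apply filter_imp; intros y Hy.
change (Rabs (RInt (F y) (- A) A - RInt (F x) (- A) A) < eps / 3) in Hy.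
change (Rabs (RInt_line (F y) - RInt_line (F x)) < eps).
assert (H1 := HT x); assert (H2 := HT y).
apply Rabs_lt_between in H1; apply Rabs_lt_between in H2; apply Rabs_lt_between in Hy.
apply Rabs_lt_between; lra.
Qed.

(** Rectangles are settled by [RInt_RInt_swap]. Truncating [y] costs at most the tail bound of one
    slice times [b - a], which tends to 0. *)
Lemma strip_Fubini (F : R -> R -> R) (C a b : R) : cont2 F ->
  (forall x y, Rabs (F x y) <= C * / (1 + y ^ 2)) -> a <= b ->
  improper_int (fun y => RInt (fun x => F x y) a b) (RInt (fun x => RInt_line (F x)) a b).
Proof.
intros HF Hd Hab.
assert (HG := strip_RInt_line_cont F C HF Hd).
apply improper_intE; intros eps He.
destruct (tail_small ((b - a) * C) eps He) as [A0 HA].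
exists (Rmax A0 0); intros u v Hu Hv.
pose proof (Rmax_l A0 0); pose proof (Rmax_r A0 0).
split.
{ apply cont_ex_RInt, (cont2_RInt (fun y x => F x y)); auto; now apply cont2_swap. }
rewrite <- RInt_RInt_swap by (auto; lra).
assert (Huv : - u <= v) by lra.
rewrite <- RInt_sub.
2: apply cont_ex_RInt; now apply cont2_RInt.
2: now apply cont_ex_RInt.
eapply Rle_lt_trans.
- apply RInt_abs_le_const with (M := C * (PI - atan u - atan v)); auto.
  + apply cont_ex_RInt; intros x; apply (continuous_minus (V := R_NormedModule)); auto.
    now apply cont2_RInt.
  + intros x; destruct (dominated_RInt_line (F x) C) as [_ H']; auto; now apply cont2_r.
- rewrite <- Rmult_assoc; apply HA; lra.
Qed.

Lemma plane_strip (F : R -> R -> R) (C : R) :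
  (forall x y, Rabs (F x y) <= C * / (1 + x ^ 2) * / (1 + y ^ 2)) ->
  forall x y, Rabs (F x y) <= C * / (1 + y ^ 2).
Proof.
intros Hd x y; eapply Rle_trans; [apply Hd|].
assert (C0 : 0 <= C).
{ specialize (Hd 0 0); pose proof (Rabs_pos (F 0 0)).
  replace (C * / (1 + 0 ^ 2) * / (1 + 0 ^ 2)) with C in Hd by field; lra. }
apply Rmult_le_compat_r; [left; apply Rinv_0_lt_compat; nra|].
rewrite <- (Rmult_1_r C) at 2; apply Rmult_le_compat_l; auto.
rewrite <- Rinv_1; apply Rinv_le_contravar; nra.
Qed.

Lemma plane_RInt_line_bound (F : R -> R -> R) (C : R) : cont2 F ->
  (forall x y, Rabs (F x y) <= C * / (1 + x ^ 2) * / (1 + y ^ 2)) ->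
  forall x, Rabs (RInt_line (F x)) <= C * PI * / (1 + x ^ 2).
Proof.
intros HF Hd x.
replace (C * PI * / (1 + x ^ 2)) with (C * / (1 + x ^ 2) * PI) by ring.
apply dominated_RInt_line_bound; auto; now apply cont2_r.
Qed.

Lemma plane_RInt_line_cont (F : R -> R -> R) (C : R) : cont2 F ->
  (forall x y, Rabs (F x y) <= C * / (1 + x ^ 2) * / (1 + y ^ 2)) ->
  forall x, continuous (fun x => RInt_line (F x)) x.
Proof. intros HF Hd; apply strip_RInt_line_cont with C; auto; now apply plane_strip. Qed.

Lemma plane_swap (F : R -> R -> R) (C : R) :
  (forall x y, Rabs (F x y) <= C * / (1 + x ^ 2) * / (1 + y ^ 2)) ->
  forall x y, Rabs (F y x) <= C * / (1 + x ^ 2) * / (1 + y ^ 2).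
Proof. intros H x y; rewrite (Rmult_assoc C), (Rmult_comm (/ _)), <- Rmult_assoc; apply H. Qed.

(** With [x] truncated to [[-a, b]], [strip_Fubini] exchanges the order. The error is then the
    integral over [y] of the tails in [x], each at most [C / (1 + y ^ 2)] times the common factor
    [PI - atan a - atan b], so it tends to 0. *)
Lemma plane_Fubini (F : R -> R -> R) (C : R) : cont2 F ->
  (forall x y, Rabs (F x y) <= C * / (1 + x ^ 2) * / (1 + y ^ 2)) ->
  improper_int (fun x => RInt_line (F x)) (RInt_line (fun y => RInt_line (fun x => F x y))).
Proof.
intros HF Hd.
assert (HF' := cont2_swap F HF); assert (Hd' := plane_swap F C Hd).
assert (Hcont := plane_RInt_line_cont F C HF Hd).
apply improper_int_tail with (C * PI); [now apply cont_ex_RInt|].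
set (U := fun y => RInt_line (fun x => F x y)).
assert (HU : improper_int U (RInt_line U)).
{ apply dominated_RInt_line with (C * PI).
  - apply (plane_RInt_line_cont (fun y x => F x y) C); auto.
  - apply (plane_RInt_line_bound (fun y x => F x y) C); auto. }
intros a b Ha Hb.
assert (Hab : - a <= b) by lra.
assert (HS := strip_Fubini F C (- a) b HF (plane_strip F C Hd) Hab).
assert (HL := improper_int_lin _ _ _ _ 1 (-1) HS HU).
replace (_ - _) with (1 * RInt (fun x => RInt_line (F x)) (- a) b + -1 * RInt_line U) by ring.
rewrite <- (RInt_line_unique _ _ HL).
replace (C * PI * (PI - atan a - atan b)) with (C * (PI - atan a - atan b) * PI) by ring.
apply dominated_RInt_line_bound.
- intros y; apply (continuous_plus (V := R_NormedModule));
    apply (continuous_scal_r (V := R_NormedModule)).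
  + now apply (cont2_RInt (fun y x => F x y)).
  + apply (plane_RInt_line_cont (fun y x => F x y) C); auto.
- intros y.
  destruct (dominated_RInt_line (fun x => F x y) (C * / (1 + y ^ 2))) as [_ H].
  + now apply cont2_l.
  + intros x; apply Hd'.
  + specialize (H a b); fold (U y) in H.
    replace (1 * _ + _) with (RInt (fun x => F x y) (- a) b - U y) by ring.
    eapply Rle_trans; [apply H|right; ring].
Qed.

(** * The density of H *)

Lemma phi_pos (x : R) : 0 < phi x.
Proof.
pose proof PI_RGT_0.
apply Rdiv_lt_0_compat; [apply exp_pos|apply sqrt_lt_R0; lra].
Qed.

Lemma phi_opp (x : R) : phi (- x) = phi x.
Proof. unfold phi; do 3 f_equal; ring. Qed.

Lemma phi_Rabs (x : R) : phi (Rabs x) = phi x.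
Proof. unfold Rabs; destruct Rcase_abs; [apply phi_opp|easy]. Qed.

Lemma is_derive_phi (x : R) : is_derive phi x (- x * phi x).
Proof.
pose proof PI_RGT_0.
assert (0 < sqrt (2 * PI)) by (apply sqrt_lt_R0; lra).
unfold phi; auto_derive; [lra|].
replace (- (x * (x * 1)) * / 2) with (- x ^ 2 / 2) by (simpl; lra); field; lra.
Qed.

Lemma continuous_phi (x : R) : continuous phi x.
Proof. apply (ex_derive_continuous (V := R_NormedModule)); eexists; apply is_derive_phi. Qed.

(** From [1 + t <= exp t] at [t = x ^ 2 / 6] follows [1 + x ^ 2 <= 6 * exp (x ^ 2 / 6)]; its cube
    cancels the Gaussian exactly and leaves [216 = 6 ^ 3]. The third power is what [joint_dominated]
    consumes. *)
Lemma phi_decay (x : R) : phi x * (1 + x ^ 2) ^ 3 <= 216.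
Proof.
assert (Hphi : phi x <= exp (- x ^ 2 / 2)).
{ pose proof PI2_1; unfold phi.
  assert (1 <= sqrt (2 * PI)) by (rewrite <- sqrt_1; apply sqrt_le_1_alt; lra).
  pose proof (exp_pos (- x ^ 2 / 2)).
  apply Rle_div_l; [lra|nra]. }
assert (HE : exp (- x ^ 2 / 2) * exp (x ^ 2 / 6) ^ 3 = 1).
{ replace (exp (x ^ 2 / 6) ^ 3) with (exp (x ^ 2 / 6 + x ^ 2 / 6 + x ^ 2 / 6))
    by (rewrite !exp_plus; ring).
  rewrite <- exp_plus, <- exp_0; f_equal; field. }
assert (HT : (1 + x ^ 2) ^ 3 <= 216 * exp (x ^ 2 / 6) ^ 3).
{ replace (216 * _) with ((6 * exp (x ^ 2 / 6)) ^ 3) by ring.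
  pose proof (pow2_ge_0 x); apply pow_incr; split; [lra|].
  pose proof (exp_ineq1_le (x ^ 2 / 6)); lra. }
pose proof (exp_pos (- x ^ 2 / 2)).
assert (0 <= (1 + x ^ 2) ^ 3) by (apply pow_le; pose proof (pow2_ge_0 x); lra).
apply Rle_trans with (exp (- x ^ 2 / 2) * (1 + x ^ 2) ^ 3); [nra|].
apply Rle_trans with (exp (- x ^ 2 / 2) * (216 * exp (x ^ 2 / 6) ^ 3)).
- apply Rmult_le_compat_l; lra.
- rewrite <- Rmult_assoc, (Rmult_comm _ 216), Rmult_assoc, HE; lra.
Qed.

(* [psi(g)] times the joint density of [(H, W)], [H = sig G + W],
   [W] standard normal, where [g = (h - w) / sig]. *)
Definition joint (sig : R) (psi : R -> R) (h w : R) : R :=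
  phi w * phi ((h - w) / sig) * psi ((h - w) / sig) / Rabs sig.

(* [S Y] is [|S|] with probability [1 - eps] and [- |S|] with probability [eps]. *)
Definition mix (eps sig : R) (psi : R -> R) (h s : R) : R :=
  (1 - eps) * joint sig psi h (Rabs s) + eps * joint sig psi h (- Rabs s).

(** Since [h = sig * g + w], the weight [1 + h ^ 2] is at most a constant times
    [(1 + g ^ 2) * (1 + w ^ 2)]. It enters twice, from [f] and from the claimed decay; with the
    growth of [psi] and the weight in [w] this makes third powers of both factors, absorbed by
    [phi_decay]. *)
Lemma joint_dominated (sig : R) (psi f : R -> R) (B : R) : sig <> 0 ->
  (forall g, Rabs (psi g) <= 1 + g ^ 2) -> (forall h, Rabs (f h) <= B * (1 + h ^ 2)) ->
  exists C, forall h w, Rabs (joint sig psi h w * f h) <= C * / (1 + h ^ 2) * / (1 + w ^ 2).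
Proof.
intros Hs Hpsi Hf.
set (D := 2 * (1 + sig ^ 2)).
assert (Ps := Rabs_pos_lt sig Hs).
exists (216 * 216 * B * D ^ 2 / Rabs sig); intros h w.
set (g := (h - w) / sig).
assert (Eh : h = sig * g + w) by (unfold g; field; auto).
pose proof (pow2_ge_0 sig); pose proof (pow2_ge_0 g); pose proof (pow2_ge_0 w).
pose proof (pow2_ge_0 h).
assert (HB : 0 <= B).
{ specialize (Hf 0); pose proof (Rabs_pos (f 0)); lra. }
assert (Hh : 1 + h ^ 2 <= D * (1 + g ^ 2) * (1 + w ^ 2)).
{ unfold D.
  assert (h ^ 2 <= 2 * (sig ^ 2 * g ^ 2) + 2 * w ^ 2).
  { rewrite Eh; pose proof (pow2_ge_0 (sig * g - w)); lra. }
  assert (0 <= sig ^ 2 * g ^ 2) by nra.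
  assert (0 <= g ^ 2 * w ^ 2) by nra.
  assert (0 <= sig ^ 2 * w ^ 2) by nra.
  assert (0 <= sig ^ 2 * g ^ 2 * w ^ 2) by nra.
  lra. }
rewrite Rmult_assoc, <- Rinv_mult.
apply Rle_div_r; [nra|].
unfold joint; fold g.
unfold Rdiv; rewrite !Rabs_mult, Rabs_inv, Rabs_Rabsolu.
rewrite (Rabs_pos_eq (phi w)), (Rabs_pos_eq (phi g)) by (left; apply phi_pos).
pose proof (phi_pos w); pose proof (phi_pos g).
assert (Ww := phi_decay w); assert (Wg := phi_decay g).
assert (Is : 0 < / Rabs sig) by now apply Rinv_0_lt_compat.
assert (K0 : Rabs (psi g) * Rabs (f h) * (1 + h ^ 2) <=
  B * D ^ 2 * (1 + g ^ 2) ^ 3 * (1 + w ^ 2) ^ 2).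
{ apply Rle_trans with ((1 + g ^ 2) * (B * (1 + h ^ 2)) * (1 + h ^ 2)).
  - apply Rmult_le_compat_r; [lra|].
    apply Rmult_le_compat; auto; apply Rabs_pos.
  - assert ((1 + h ^ 2) ^ 2 <= (D * (1 + g ^ 2) * (1 + w ^ 2)) ^ 2) by (apply pow_incr; lra).
    replace ((1 + g ^ 2) * (B * (1 + h ^ 2)) * (1 + h ^ 2))
      with ((1 + g ^ 2) * B * (1 + h ^ 2) ^ 2) by ring.
    replace (B * D ^ 2 * (1 + g ^ 2) ^ 3 * (1 + w ^ 2) ^ 2)
      with ((1 + g ^ 2) * B * (D * (1 + g ^ 2) * (1 + w ^ 2)) ^ 2) by ring.
    apply Rmult_le_compat_l; [nra|lra]. }
replace (phi w * phi g * Rabs (psi g) * / Rabs sig * Rabs (f h) * ((1 + h ^ 2) * (1 + w ^ 2)))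
  with (/ Rabs sig * (phi w * phi g * (1 + w ^ 2)) * (Rabs (psi g) * Rabs (f h) * (1 + h ^ 2)))
  by ring.
apply Rle_trans with (/ Rabs sig * (phi w * phi g * (1 + w ^ 2)) *
  (B * D ^ 2 * (1 + g ^ 2) ^ 3 * (1 + w ^ 2) ^ 2)).
{ apply Rmult_le_compat_l; auto.
  apply Rmult_le_pos; [lra|]; apply Rmult_le_pos; [nra|lra]. }
replace (/ Rabs sig * (phi w * phi g * (1 + w ^ 2)) *
  (B * D ^ 2 * (1 + g ^ 2) ^ 3 * (1 + w ^ 2) ^ 2))
  with (/ Rabs sig * B * D ^ 2 * ((phi w * (1 + w ^ 2) ^ 3) * (phi g * (1 + g ^ 2) ^ 3))) by ring.
replace (216 * 216 * B * D ^ 2 * / Rabs sig) with (/ Rabs sig * B * D ^ 2 * (216 * 216)) by ring.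
apply Rmult_le_compat_l.
{ apply Rmult_le_pos; [nra|apply pow2_ge_0]. }
apply Rmult_le_compat; auto; apply Rmult_le_pos; try lra; apply pow_le; lra.
Qed.

Lemma joint_cont2 (sig : R) (psi : R -> R) : (forall g, continuous psi g) ->
  cont2 (joint sig psi).
Proof.
intros Hpsi z; unfold joint, Rdiv.
assert (Hg : continuous (fun z : R * R => (fst z - snd z) * / sig) z).
{ apply (continuous_mult (K := R_AbsRing)); [|apply continuous_const].
  apply (continuous_minus (V := R_NormedModule)); [apply continuous_fst|apply continuous_snd]. }
apply (continuous_mult (K := R_AbsRing)); [|apply continuous_const].
apply (continuous_mult (K := R_AbsRing)); [apply (continuous_mult (K := R_AbsRing))|].
- apply continuous_comp; [apply continuous_snd|apply continuous_phi].
- now apply (continuous_comp _ phi); [|apply continuous_phi].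
- now apply (continuous_comp _ psi).
Qed.

Lemma mix_cont2 (eps sig : R) (psi f : R -> R) : (forall g, continuous psi g) ->
  (forall h, continuous f h) -> cont2 (fun h s => mix eps sig psi h s * f h).
Proof.
intros Hpsi Hf z; unfold mix.
assert (HA : continuous (fun z : R * R => Rabs (snd z)) z).
{ apply (continuous_comp (fun z : R * R => snd z) Rabs);
    [apply continuous_snd|apply continuous_Rabs]. }
apply (continuous_mult (K := R_AbsRing)).
- apply (continuous_plus (V := R_NormedModule));
    apply (continuous_scal_r (V := R_NormedModule)).
  + apply (continuous_comp_2 (fun z : R * R => fst z) (fun z : R * R => Rabs (snd z))
      (joint sig psi)); [apply continuous_fst|easy|now apply joint_cont2].
  + apply (continuous_comp_2 (fun z : R * R => fst z) (fun z : R * R => - Rabs (snd z))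
      (joint sig psi)); [apply continuous_fst| |now apply joint_cont2].
    now apply (continuous_opp (V := R_NormedModule)).
- apply continuous_comp; [apply continuous_fst|apply Hf].
Qed.

Lemma mix_dominated (eps sig : R) (psi f : R -> R) (B : R) : 0 <= eps <= 1 -> sig <> 0 ->
  (forall g, Rabs (psi g) <= 1 + g ^ 2) -> (forall h, Rabs (f h) <= B * (1 + h ^ 2)) ->
  exists C, forall h s, Rabs (mix eps sig psi h s * f h) <= C * / (1 + h ^ 2) * / (1 + s ^ 2).
Proof.
intros He Hs Hpsi Hf.
destruct (joint_dominated sig psi f B Hs Hpsi Hf) as [C HC].
exists C; intros h s; unfold mix.
assert (H1 := HC h (Rabs s)); assert (H2 := HC h (- Rabs s)).
replace ((- Rabs s) ^ 2) with (Rabs s ^ 2) in H2 by ring.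
rewrite pow2_abs in H1, H2.
apply Rabs_le_between in H1; apply Rabs_le_between in H2.
apply Rabs_le_between; rewrite Rmult_plus_distr_r, !Rmult_assoc; nra.
Qed.

(** * From expectations over [(G, S, Y)] to integrals over [h] *)

Lemma improper_int_affine (m : R -> R) (sig w L : R) : sig <> 0 ->
  improper_int m L -> improper_int (fun g => Rabs sig * m (sig * g + w)) L.
Proof.
intros Hs Hm; apply improper_intE; intros eps He.
destruct (proj1 (improper_intE m L) Hm eps He) as [A HA].
assert (Ps := Rabs_pos_lt sig Hs).
exists ((Rabs A + Rabs w) / Rabs sig); intros a b Ha Hb.
apply Rle_div_l in Ha; auto; apply Rle_div_l in Hb; auto.
pose proof (Rle_abs A); pose proof (Rle_abs w); pose proof (Rle_abs (- w)).
rewrite Rabs_Ropp in *.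
(* The sign of [mu] is not fixed, so [sig] may be negative; the substitution then reverses the
   line. *)
destruct (Rcase_abs sig) as [Hneg|Hpos].
- rewrite (Rabs_left sig Hneg) in *.
  destruct (HA (- (sig * b + w)) (sig * - a + w)) as [HE HR]; [lra..|].
  rewrite Ropp_involutive in HE, HR.
  assert (HI : is_RInt (fun g => - sig * m (sig * g + w)) (- a) b
                 (RInt m (sig * b + w) (sig * - a + w))).
  { apply (is_RInt_ext (fun g => opp (sig * m (sig * g + w)))).
    { intros x _; unfold opp; simpl; ring. }
    rewrite <- (opp_opp (RInt m _ _)).
    apply (is_RInt_opp (V := R_NormedModule)).
    apply (is_RInt_comp_lin (V := R_NormedModule) m).
    apply (is_RInt_swap (V := R_NormedModule)).
    now apply (RInt_correct (V := R_CompleteNormedModule)). }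
  split; [eexists; exact HI|now rewrite (is_RInt_unique _ _ _ _ HI)].
- rewrite (Rabs_right sig Hpos) in *.
  destruct (HA (- (sig * - a + w)) (sig * b + w)) as [HE HR]; [lra..|].
  rewrite Ropp_involutive in HE, HR.
  assert (HI : is_RInt (fun g => sig * m (sig * g + w)) (- a) b
                 (RInt m (sig * - a + w) (sig * b + w))).
  { apply (is_RInt_comp_lin (V := R_NormedModule) m).
    now apply (RInt_correct (V := R_CompleteNormedModule)). }
  split; [eexists; exact HI|now rewrite (is_RInt_unique _ _ _ _ HI)].
Qed.

Lemma mult_sgn (s : R) : s * sgn s = Rabs s.
Proof. unfold sgn, Rabs; destruct Rlt_dec, Rcase_abs; lra. Qed.

(* The integrand of [expect_GSY] at fixed [s], after the substitution [h = sig * g + w]. *)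
Lemma improper_int_mix (eps sig : R) (psi m : R -> R) (s L1 L2 : R) : sig <> 0 ->
  improper_int (fun h => joint sig psi h (Rabs s) * m h) L1 ->
  improper_int (fun h => joint sig psi h (- Rabs s) * m h) L2 ->
  improper_int (fun g => phi g * phi s *
    ((1 - eps) * (psi g * m (sig * g + s * sgn s)) +
     eps * (psi g * m (sig * g + s * - sgn s)))) ((1 - eps) * L1 + eps * L2).
Proof.
intros Hs H1 H2.
assert (Ps := Rabs_pos_lt sig Hs).
apply (improper_int_affine _ sig (Rabs s)) in H1; auto.
apply (improper_int_affine _ sig (- Rabs s)) in H2; auto.
eapply improper_int_ext; [|exact (improper_int_lin _ _ _ _ (1 - eps) eps H1 H2)].
intros g; unfold joint; simpl.
replace (s * - sgn s) with (- (s * sgn s)) by ring; rewrite mult_sgn.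
replace ((sig * g + Rabs s - Rabs s) / sig) with g by (field; auto).
replace ((sig * g + - Rabs s - - Rabs s) / sig) with g by (field; auto).
rewrite phi_opp, phi_Rabs; field; lra.
Qed.

Lemma improper_int_unique (f : R -> R) (L M : R) :
  improper_int f L -> improper_int f M -> L = M.
Proof. intros HL HM; apply RInt_line_unique in HL; apply RInt_line_unique in HM; congruence. Qed.

Lemma improper_int_scal (c : R) (f : R -> R) (L : R) :
  improper_int f L -> improper_int (fun x => c * f x) (c * L).
Proof.
intros H; replace (c * L) with (c * L + 0 * L) by ring.
eapply improper_int_ext; [|exact (improper_int_lin _ _ _ _ c 0 H H)].
intros x; simpl; ring.
Qed.

(* [marg eps sig psi h] is [E[psi(G) | H = h] p h]. *)
Definition marg (eps sig : R) (psi : R -> R) (h : R) : R := RInt_line (mix eps sig psi h).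

Lemma mix_dominated_1 (eps sig : R) (psi : R -> R) : 0 <= eps <= 1 -> sig <> 0 ->
  (forall g, Rabs (psi g) <= 1 + g ^ 2) ->
  exists C, forall h s, Rabs (mix eps sig psi h s) <= C * / (1 + h ^ 2) * / (1 + s ^ 2).
Proof.
intros He Hs Hp.
destruct (mix_dominated eps sig psi (fun _ => 1) 1 He Hs Hp) as [C HC].
{ intros h; rewrite Rabs_R1; pose proof (pow2_ge_0 h); lra. }
exists C; intros h s; rewrite <- (Rmult_1_r (mix _ _ _ _ _)); apply HC.
Qed.

Lemma mix_cont2_1 (eps sig : R) (psi : R -> R) : (forall g, continuous psi g) ->
  cont2 (mix eps sig psi).
Proof.
intros Hp z.
apply (continuous_ext (fun z => mix eps sig psi (fst z) (snd z) * 1)).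
- intros; apply Rmult_1_r.
- apply (mix_cont2 eps sig psi (fun _ => 1)); auto; intros; apply continuous_const.
Qed.

Lemma marg_improper (eps sig : R) (psi : R -> R) (h : R) : 0 <= eps <= 1 -> sig <> 0 ->
  (forall g, continuous psi g) -> (forall g, Rabs (psi g) <= 1 + g ^ 2) ->
  improper_int (mix eps sig psi h) (marg eps sig psi h).
Proof.
intros He Hs Hc Hp; destruct (mix_dominated_1 eps sig psi He Hs Hp) as [C HC].
apply dominated_RInt_line with (C * / (1 + h ^ 2)); auto.
now apply cont2_r, mix_cont2_1.
Qed.

Lemma marg_cont (eps sig : R) (psi : R -> R) (h : R) : 0 <= eps <= 1 -> sig <> 0 ->
  (forall g, continuous psi g) -> (forall g, Rabs (psi g) <= 1 + g ^ 2) ->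
  continuous (marg eps sig psi) h.
Proof.
intros He Hs Hc Hp; destruct (mix_dominated_1 eps sig psi He Hs Hp) as [C HC].
apply (plane_RInt_line_cont _ C); auto; now apply mix_cont2_1.
Qed.

(** The expectation integrates over [g] first. For fixed [s] the substitution turns this into an
    integral of [mix * f] over [h]; Fubini then makes [s] the inner variable, and [f h] leaves the
    inner integral. *)
Lemma expect_marg (eps sig : R) (psi f : R -> R) (B L : R) :
  0 <= eps <= 1 -> sig <> 0 ->
  (forall g, continuous psi g) -> (forall g, Rabs (psi g) <= 1 + g ^ 2) ->
  (forall h, continuous f h) -> (forall h, Rabs (f h) <= B * (1 + h ^ 2)) ->
  expect_GSY eps (fun g s y => psi g * f (sig * g + s * y)) L ->
  improper_int (fun h => f h * marg eps sig psi h) L.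
Proof.
intros He Hs Hpc Hp Hfc Hf [k [Hin Hout]].
destruct (mix_dominated eps sig psi f B He Hs Hp Hf) as [C HC].
destruct (joint_dominated sig psi f B Hs Hp Hf) as [D HD].
assert (Hcont := mix_cont2 eps sig psi f Hpc Hfc).
assert (HJ : forall w, improper_int (fun h => joint sig psi h w * f h)
                         (RInt_line (fun h => joint sig psi h w * f h))).
{ intros w; apply dominated_RInt_line with (D * / (1 + w ^ 2)).
  - intros h; apply (continuous_mult (K := R_AbsRing)); auto.
    apply (cont2_l (joint sig psi)); now apply joint_cont2.
  - intros h; eapply Rle_trans; [apply HD|right; ring]. }
assert (Hk : forall s, k s = RInt_line (fun h => mix eps sig psi h s * f h)).
{ intros s.
  rewrite (improper_int_unique _ _ _ (Hin s)
    (improper_int_mix eps sig psi f s _ _ Hs (HJ (Rabs s)) (HJ (- Rabs s)))).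
  symmetry; apply RInt_line_unique.
  eapply improper_int_ext;
    [|exact (improper_int_lin _ _ _ _ (1 - eps) eps (HJ (Rabs s)) (HJ (- Rabs s)))].
  intros h; unfold mix; simpl; ring. }
assert (HF := plane_Fubini _ C Hcont HC).
rewrite (RInt_line_unique _ L) in HF by (apply (improper_int_ext k); auto).
revert HF; apply improper_int_ext; intros h; apply RInt_line_unique.
apply (improper_int_ext (fun s => f h * mix eps sig psi h s)); [intros; ring|].
now apply improper_int_scal, marg_improper.
Qed.

(** * Identification of the density *)

Lemma improper_int_interval (k : R -> R) (a b : R) : a < b ->
  (forall x, continuous k x) ->
  improper_int (fun h => k h *
    (if Rlt_dec a h then (if Rlt_dec h b then 1 else 0) else 0)) (RInt k a b).
Proof.
intros Hab Hk; set (f := fun h => _).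
apply improper_intE; intros eps He.
(* From here on the window contains [[a, b]]. The indicator is discontinuous, so the integral is cut
   at [a] and [b] and computed exactly instead of being dominated. *)
exists (Rmax (- a) b); intros u v Hu Hv.
pose proof (Rmax_l (- a) b); pose proof (Rmax_r (- a) b).
assert (Zero : forall c d, c <= d -> d <= a \/ b <= c -> is_RInt f c d 0).
{ intros c d Hcd Ho; apply (is_RInt_ext (fun _ => 0)).
  - intros x; rewrite Rmin_left, Rmax_right by lra; intros Hx; unfold f.
    destruct (Rlt_dec a x), (Rlt_dec x b); lra.
  - exact (eq_ind _ (is_RInt (V := R_NormedModule) (fun _ : R => 0) c d)
      (is_RInt_const (V := R_NormedModule) c d 0) _ (Rmult_0_r (d - c))). }
assert (HI : is_RInt f (- u) v (RInt k a b)).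
{ replace (RInt k a b : R) with (plus (plus 0 (RInt k a b)) 0)
    by (unfold plus; simpl; now rewrite Rplus_0_l, Rplus_0_r).
  apply (is_RInt_Chasles (V := R_NormedModule)) with b;
    [apply (is_RInt_Chasles (V := R_NormedModule)) with a|].
  - apply Zero; lra.
  - apply (is_RInt_ext k).
    + intros x; rewrite Rmin_left, Rmax_right by lra; intros Hx; unfold f.
      destruct (Rlt_dec a x), (Rlt_dec x b); lra.
    + now apply (RInt_correct (V := R_CompleteNormedModule)), cont_ex_RInt.
  - apply Zero; lra. }
split; [eexists; exact HI|].
rewrite (is_RInt_unique _ _ _ _ HI), Rminus_diag, Rabs_R0; lra.
Qed.

Definition cst1 : R -> R := fun _ => 1.

Lemma cst1_cont (g : R) : continuous cst1 g.
Proof. apply continuous_const. Qed.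

Lemma cst1_bound (g : R) : Rabs (cst1 g) <= 1 + g ^ 2.
Proof. unfold cst1; rewrite Rabs_R1; pose proof (pow2_ge_0 g); lra. Qed.

Lemma id_bound (g : R) : Rabs g <= 1 + g ^ 2.
Proof. apply Rabs_le; nra. Qed.

Lemma RInt_eq_cont_eq (p q : R -> R) :
  (forall x, continuous p x) -> (forall x, continuous q x) ->
  (forall a b, a < b -> RInt p a b = RInt q a b) -> forall x, p x = q x.
Proof.
intros Hp Hq H x.
(* Both values are derivatives of integrals based at [x - 1]; in the unit ball around [x] the upper
   limit stays above this base, as the hypothesis requires. *)
rewrite <- (Derive_RInt p (x - 1) x), <- (Derive_RInt q (x - 1) x); auto.
2, 3: apply filter_forall; intros y; now apply cont_ex_RInt.
apply Derive_ext_loc.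
exists (mkposreal 1 Rlt_0_1); intros y Hy.
change (Rabs (y - x) < 1) in Hy; apply Rabs_lt_between in Hy.
apply H; lra.
Qed.

Lemma mix_strip (eps sig : R) (psi : R -> R) (a b : R) : 0 <= eps <= 1 -> sig <> 0 ->
  (forall g, continuous psi g) -> (forall g, Rabs (psi g) <= 1 + g ^ 2) -> a <= b ->
  improper_int (fun s => RInt (fun h => mix eps sig psi h s) a b)
    (RInt (marg eps sig psi) a b).
Proof.
intros He Hs Hc Hp Hab; destruct (mix_dominated_1 eps sig psi He Hs Hp) as [C HC].
apply (strip_Fubini (mix eps sig psi) C); auto; [now apply mix_cont2_1|].
now apply plane_strip.
Qed.

(** Probabilities of intervals determine a continuous density pointwise. [expect_marg] needs a
    continuous [f] and so cannot take an indicator; [mix_strip] over [[a, b]] replaces it. *)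
Lemma density_marg (eps sig : R) (p : R -> R) : 0 <= eps <= 1 -> sig <> 0 ->
  is_density_H eps sig p -> (forall x, continuous p x) ->
  forall h, p h = marg eps sig cst1 h.
Proof.
intros He Hs HpH Hpc.
assert (Hj : forall w, forall h, continuous (fun h => joint sig cst1 h w) h).
{ intros w; apply (cont2_l (joint sig cst1)), joint_cont2, cst1_cont. }
apply RInt_eq_cont_eq; auto.
{ intros; apply marg_cont; auto; [apply cst1_cont|apply cst1_bound]. }
intros a b Hab.
destruct (HpH a b Hab) as [pr [k [Hin Hout]]].
rewrite (RInt_Reals _ _ _ pr).
apply (improper_int_unique k); auto.
apply (improper_int_ext (fun s => RInt (fun h => mix eps sig cst1 h s) a b)).
2: { apply mix_strip; auto; [apply cst1_cont|apply cst1_bound|lra]. }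
intros s.
assert (H1 := improper_int_interval _ a b Hab (Hj (Rabs s))).
assert (H2 := improper_int_interval _ a b Hab (Hj (- Rabs s))).
assert (H3 := improper_int_mix eps sig cst1 _ s _ _ Hs H1 H2).
eapply improper_int_ext in H3; [rewrite (improper_int_unique _ _ _ (Hin s) H3)|].
- apply is_RInt_unique.
  apply (is_RInt_plus (V := R_NormedModule)
    (fun h => (1 - eps) * joint sig cst1 h (Rabs s)) (fun h => eps * joint sig cst1 h (- Rabs s)));
    apply (is_RInt_scal (V := R_NormedModule));
    now apply (RInt_correct (V := R_CompleteNormedModule)), cont_ex_RInt.
- intros g; unfold cst1; cbv beta; now rewrite !Rmult_1_l.
Qed.

(** * Derivative and positivity of the density, conditional moments of [G] *)

Lemma is_derive_joint (sig h w : R) : sig <> 0 ->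
  is_derive (fun h => joint sig cst1 h w) h (- / sig * joint sig (fun g => g) h w).
Proof.
intros Hs; assert (Ps := Rabs_pos_lt sig Hs).
apply (is_derive_ext (fun h => (phi w / Rabs sig) * phi ((h - w) / sig))).
{ intros t; unfold joint, cst1; change (@eq R (phi w / Rabs sig * phi ((t - w) / sig)) (phi w * phi ((t - w) / sig) * 1 / Rabs sig)); field; lra. }
replace (- / sig * joint sig (fun g => g) h w)
  with (phi w / Rabs sig * (/ sig * (- ((h - w) / sig) * phi ((h - w) / sig))))
  by (unfold joint; field; lra).
apply (is_derive_scal (fun h => phi ((h - w) / sig))).
apply (is_derive_comp (V := R_NormedModule) phi (fun h => (h - w) / sig)).
- apply is_derive_phi.
- auto_derive; [auto|now field].
Qed.

(** Differentiation under the improper integral, obtained by integrating: the [h]-derivative of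
    [mix] is integrated over [[a, b]], [mix_strip] exchanges the integrals, and the result is
    differentiated in [b]. *)
Lemma marg_derive (eps sig h : R) : 0 <= eps <= 1 -> sig <> 0 ->
  is_derive (marg eps sig cst1) h (- / sig * marg eps sig (fun g => g) h).
Proof.
intros He Hs.
set (psi := fun g : R => g).
assert (Hc : forall g, continuous psi g) by (intros; apply continuous_id).
assert (HD : forall h s, is_derive (fun h => mix eps sig cst1 h s) h
                           (- / sig * mix eps sig psi h s)).
{ intros x s; unfold mix.
  replace (- / sig * _) with ((1 - eps) * (- / sig * joint sig psi x (Rabs s)) +
    eps * (- / sig * joint sig psi x (- Rabs s))) by ring.
  apply (is_derive_plus (V := R_NormedModule));
    apply is_derive_scal; now apply is_derive_joint. }
assert (HM : forall x, continuous (marg eps sig psi) x).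
{ intros; apply marg_cont; auto; apply id_bound. }
set (a := h - 1).
assert (HI : forall b, a <= b ->
  marg eps sig cst1 b = marg eps sig cst1 a + - / sig * RInt (marg eps sig psi) a b).
{ intros b Hab.
  assert (H1 := mix_strip eps sig psi a b He Hs Hc id_bound Hab).
  assert (H2 := marg_improper eps sig cst1 a He Hs cst1_cont cst1_bound).
  assert (H3 := marg_improper eps sig cst1 b He Hs cst1_cont cst1_bound).
  rewrite <- (Rmult_1_l (marg eps sig cst1 a)).
  apply (improper_int_unique _ _ _ H3).
  eapply improper_int_ext; [|exact (improper_int_lin _ _ _ _ 1 (- / sig) H2 H1)].
  intros s; cbv beta.
  assert (HR : is_RInt (fun h => - / sig * mix eps sig psi h s) a b
     (minus (mix eps sig cst1 b s) (mix eps sig cst1 a s))).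
  { apply (is_RInt_derive (V := R_CompleteNormedModule) (fun h => mix eps sig cst1 h s)).
    - intros; apply HD.
    - intros x _; apply (continuous_scal_r (V := R_NormedModule)).
      apply (cont2_l (mix eps sig psi)); now apply mix_cont2_1. }
  assert (HR2 : is_RInt (fun h => - / sig * mix eps sig psi h s) a b
     (- / sig * RInt (fun h => mix eps sig psi h s) a b)).
  { apply (is_RInt_scal (V := R_NormedModule) (fun h => mix eps sig psi h s)).
    apply (RInt_correct (V := R_CompleteNormedModule)), cont_ex_RInt.
    apply (cont2_l (mix eps sig psi)); now apply mix_cont2_1. }
  apply (is_RInt_unique (V := R_CompleteNormedModule)) in HR, HR2.
  rewrite HR in HR2; unfold minus, plus, opp in HR2; simpl in HR2; lra. }
apply (is_derive_ext_loc
  (fun b => marg eps sig cst1 a + - / sig * RInt (marg eps sig psi) a b)).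
{ exists (mkposreal 1 Rlt_0_1); intros y Hy.
  change (Rabs (y - h) < 1) in Hy; apply Rabs_lt_between in Hy.
  symmetry; apply HI; unfold a; lra. }
rewrite <- (Rplus_0_l (- / sig * _)).
apply (is_derive_plus (V := R_NormedModule)).
- apply (is_derive_const (V := R_NormedModule)).
- apply is_derive_scal, (is_derive_RInt (V := R_NormedModule) _ _ a); auto.
  apply filter_forall; intros b.
  now apply (RInt_correct (V := R_CompleteNormedModule)), cont_ex_RInt.
Qed.

Lemma improper_int_pos (f : R -> R) (L : R) :
  (forall x, continuous f x) -> (forall x, 0 < f x) -> improper_int f L -> 0 < L.
Proof.
intros Hc Hf HL.
assert (P0 : 0 < RInt f (- 1) 1) by (apply RInt_gt_0; auto; lra).
apply Rlt_le_trans with (1 := P0), Rnot_lt_le; intros Hlt.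
destruct (proj1 (improper_intE f L) HL (RInt f (- 1) 1 - L)) as [A HA]; [lra|].
pose proof (Rmax_l A 1); pose proof (Rmax_r A 1).
destruct (HA (Rmax A 1) (Rmax A 1)) as [_ HR]; [lra..|].
set (M := Rmax A 1) in *.
assert (N1 : 0 <= RInt f (- M) (- 1))
  by (apply RInt_ge_0; [lra|now apply cont_ex_RInt|intros; now left]).
assert (N2 : 0 <= RInt f 1 M)
  by (apply RInt_ge_0; [lra|now apply cont_ex_RInt|intros; now left]).
assert (E1 := cont_RInt_Chasles f (- M) (- 1) 1 Hc).
assert (E2 := cont_RInt_Chasles f (- M) 1 M Hc).
apply Rabs_lt_between in HR; lra.
Qed.

Lemma marg_pos (eps sig h : R) : 0 <= eps <= 1 -> sig <> 0 -> 0 < marg eps sig cst1 h.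
Proof.
intros He Hs.
apply (improper_int_pos (mix eps sig cst1 h)).
- apply cont2_r, mix_cont2_1, cst1_cont.
- intros s; unfold mix.
  assert (HJ : forall w, 0 < joint sig cst1 h w).
  { intros w; unfold joint, cst1; apply Rdiv_lt_0_compat; [|now apply Rabs_pos_lt].
    rewrite Rmult_1_r; apply Rmult_lt_0_compat; apply phi_pos. }
  assert (H1 := HJ (Rabs s)); assert (H2 := HJ (- Rabs s)).
  (* Either weight may vanish, but one of them is at least 1/2. *)
  destruct (Rle_dec eps (1 / 2)); nra.
- apply marg_improper; auto; [apply cst1_cont|apply cst1_bound].
Qed.

Lemma sqr_cont (g : R) : continuous (fun g => g ^ 2) g.
Proof. apply (ex_derive_continuous (V := R_NormedModule)); auto_derive; auto. Qed.

Lemma sqr_bound (g : R) : Rabs (g ^ 2) <= 1 + g ^ 2.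
Proof. rewrite Rabs_pos_eq; pose proof (pow2_ge_0 g); lra. Qed.

(** The conditional variance of [G] given [H = h], times the density, is nonnegative; [c] below is
    the conditional mean. This provides the integrable bound on the Fisher integrand. *)
Lemma marg_Cauchy_Schwarz (eps sig h : R) : 0 <= eps <= 1 -> sig <> 0 ->
  marg eps sig (fun g => g) h ^ 2 / marg eps sig cst1 h <= marg eps sig (fun g => g ^ 2) h.
Proof.
intros He Hs.
assert (H0 := marg_improper eps sig cst1 h He Hs cst1_cont cst1_bound).
assert (H1 := marg_improper eps sig (fun g => g) h He Hs (fun g => continuous_id g) id_bound).
assert (H2 := marg_improper eps sig (fun g => g ^ 2) h He Hs sqr_cont sqr_bound).
assert (Hpos := marg_pos eps sig h He Hs).
set (m0 := marg eps sig cst1 h) in *; set (m1 := marg eps sig (fun g => g) h) in *.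
set (m2 := marg eps sig (fun g => g ^ 2) h) in *.
set (c := m1 / m0).
assert (HL := improper_int_lin _ _ _ _ 1 (c ^ 2) H2 H0).
assert (HL2 := improper_int_lin _ _ _ _ 1 (- (2 * c)) HL H1).
apply improper_int_ge0 in HL2.
- replace (m1 ^ 2 / m0) with (2 * c * m1 - c ^ 2 * m0) by (unfold c; field; lra); lra.
- intros s; unfold mix.
  replace (_ + _) with
    ((1 - eps) * (joint sig cst1 h (Rabs s) * ((h - Rabs s) / sig - c) ^ 2) +
     eps * (joint sig cst1 h (- Rabs s) * ((h - - Rabs s) / sig - c) ^ 2))
    by (unfold joint, cst1; field; auto using Rabs_no_R0).
  assert (HJ : forall w, 0 <= joint sig cst1 h w).
  { intros w; unfold joint, cst1; left; apply Rdiv_lt_0_compat; [|now apply Rabs_pos_lt].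
    rewrite Rmult_1_r; apply Rmult_lt_0_compat; apply phi_pos. }
  apply Rplus_le_le_0_compat; (apply Rmult_le_pos; [lra|]);
    (apply Rmult_le_pos; [apply HJ|apply pow2_ge_0]).
Qed.

(** * Derivative of the Moreau envelope *)

(* First-order optimality of the proximal point [v], in a form that does not
   differentiate [l]. *)
Lemma prox_variational (l : R -> R) (lam x v w : R) : convex_fun l -> 0 < lam ->
  (forall u, (x - v) ^ 2 / (2 * lam) + l v <= (x - u) ^ 2 / (2 * lam) + l u) ->
  (x - v) * (w - v) <= lam * (l w - l v).
Proof.
intros Hl Hlam Hmin; apply le_epsilon; intros e He.
set (K := (w - v) ^ 2).
assert (HK : 0 <= K) by apply pow2_ge_0.
set (t := Rmin 1 (e / (K + 1))).
assert (He' : 0 < e / (K + 1)) by (apply Rdiv_lt_0_compat; lra).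
assert (Ht : 0 < t <= 1).
{ split; [apply Rmin_glb_lt; lra|apply Rmin_l]. }
assert (HtK : t * K <= e).
{ apply Rle_trans with (e / (K + 1) * K).
  - apply Rmult_le_compat_r; [easy|apply Rmin_r].
  - assert (e = e / (K + 1) * (K + 1)) by (field; lra); nra. }
(* The minimiser is compared with a point a fraction [t] of the way to [w]. After division by [t]
   the quadratic term leaves an error of order [t * K], and [t] was chosen to make this at most
   [e]. *)
specialize (Hmin (t * w + (1 - t) * v)).
assert (Hc := Hl w v t ltac:(lra)).
assert (Hm2 : (x - v) ^ 2 / (2 * lam) <=
  (x - (t * w + (1 - t) * v)) ^ 2 / (2 * lam) + t * (l w - l v)) by lra.
apply (Rmult_le_compat_l (2 * lam)) in Hm2; [|lra].
replace (2 * lam * ((x - v) ^ 2 / (2 * lam))) with ((x - v) ^ 2) in Hm2 by (field; lra).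
replace (2 * lam * ((x - (t * w + (1 - t) * v)) ^ 2 / (2 * lam) + t * (l w - l v)))
  with ((x - v) ^ 2 + t * (2 * (lam * (l w - l v)) - 2 * ((x - v) * (w - v)) + t * K))
  in Hm2 by (unfold K; field; lra).
assert (0 <= 2 * (lam * (l w - l v)) - 2 * ((x - v) * (w - v)) + t * K) by nra.
lra.
Qed.

(** Envelope argument: with the proximal point [v] of [x] held fixed,
    [(z - v) ^ 2 / (2 * lam) - M z] is minimal at [z = x], so its derivative vanishes there. *)
Lemma moreau_deriv (l M : R -> R) (lam x d : R) : convex_fun l -> 0 < lam ->
  (forall z, is_moreau l lam z (M z)) -> derivable_pt_lim M x d ->
  exists v, d = (x - v) / lam /\
    forall w, (x - v) * (w - v) <= lam * (l w - l v).
Proof.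
intros Hl Hlam HM Hd.
destruct (HM x) as [[v Hv] Hmin]; exists v; split.
- set (f := fun z => (z - v) ^ 2 / (2 * lam) - M z).
  assert (Hf : derivable_pt_lim f x ((x - v) / lam - d)).
  { apply is_derive_Reals; apply is_derive_Reals in Hd.
    apply (is_derive_minus (V := R_NormedModule)); auto.
    auto_derive; [auto|field; lra]. }
  assert (H0 := deriv_minimum f (x - 1) (x + 1) x (exist _ _ Hf) ltac:(lra) ltac:(lra)).
  simpl in H0; enough ((x - v) / lam - d = 0) by lra; apply H0.
  intros z _ _; unfold f; destruct (HM z) as [_ Hz]; specialize (Hz v); lra.
- intros w; apply prox_variational; auto; intros u; rewrite <- Hv; apply Hmin.
Qed.

(** Adding the variational inequalities at [x] and [y] cancels [l] and leaves
    [(w - v) ^ 2 <= (y - x) * (w - v)], so the proximal map is nonexpansive. The factor 2 comes from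
    a crude triangle inequality; any constant would do. *)
Lemma moreau_deriv_Lipschitz (l M dM : R -> R) (lam : R) : convex_fun l -> 0 < lam ->
  (forall z, is_moreau l lam z (M z)) -> (forall z, derivable_pt_lim M z (dM z)) ->
  forall x y, Rabs (dM y - dM x) <= 2 / lam * Rabs (y - x).
Proof.
intros Hl Hlam HM Hd x y.
destruct (moreau_deriv l M lam x _ Hl Hlam HM (Hd x)) as [v [-> Hv]].
destruct (moreau_deriv l M lam y _ Hl Hlam HM (Hd y)) as [w [-> Hw]].
specialize (Hv w); specialize (Hw v).
assert (Hvw : Rabs (w - v) <= Rabs (y - x)).
{ apply Rsqr_le_abs_0; pose proof (pow2_ge_0 ((y - x) - (w - v))); unfold Rsqr; lra. }
replace ((y - w) / lam - (x - v) / lam) with (/ lam * ((y - x) - (w - v))) by (field; lra).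
assert (Il : 0 < / lam) by now apply Rinv_0_lt_compat.
rewrite Rabs_mult, (Rabs_pos_eq (/ lam)) by lra.
unfold Rdiv; rewrite (Rmult_comm 2), Rmult_assoc.
apply Rmult_le_compat_l; [lra|].
eapply Rle_trans; [apply Rabs_triang|]; rewrite Rabs_Ropp; lra.
Qed.

Lemma Lipschitz_continuous (f : R -> R) (K : R) :
  (forall x y, Rabs (f y - f x) <= K * Rabs (y - x)) -> forall x, continuous f x.
Proof.
intros HK x; apply filterlim_locally; intros eps.
pose proof (Rabs_pos K); pose proof (cond_pos eps).
assert (He : 0 < eps / (Rabs K + 1)) by (apply Rdiv_lt_0_compat; lra).
exists (mkposreal _ He); intros y Hy.
change (Rabs (y - x) < eps / (Rabs K + 1)) in Hy.
change (Rabs (f y - f x) < eps).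
pose proof (Rabs_pos (y - x)); pose proof (Rle_abs K); pose proof (HK x y).
assert (pos eps = (Rabs K + 1) * (eps / (Rabs K + 1))) by (field; lra).
set (e := eps / _) in *.
nra.
Qed.

Lemma Lipschitz_growth (f : R -> R) (K : R) :
  (forall x y, Rabs (f y - f x) <= K * Rabs (y - x)) ->
  exists B, (forall x, Rabs (f x) <= B * (1 + x ^ 2)) /\
            (forall x, Rabs (f x ^ 2) <= B * (1 + x ^ 2)).
Proof.
intros HK.
set (c := Rabs (f 0) + K).
assert (K0 : 0 <= K).
{ specialize (HK 0 1); rewrite Rminus_0_r, Rabs_R1 in HK.
  pose proof (Rabs_pos (f 1 - f 0)); lra. }
pose proof (Rabs_pos (f 0)).
assert (Hc : 0 <= c) by (unfold c; lra).
assert (Hlin : forall x, Rabs (f x) <= c * (1 + Rabs x)).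
{ intros x; specialize (HK 0 x); rewrite Rminus_0_r in HK.
  pose proof (Rabs_triang_inv (f x) (f 0)); pose proof (Rabs_pos x); unfold c; nra. }
(* The term [2 * c] serves [f] and [2 * c ^ 2] serves its square, the two functions later passed to
   [expect_marg]. *)
exists (2 * c + 2 * c ^ 2); split; intros x; specialize (Hlin x);
  pose proof (Rabs_pos x) as Px; pose proof (pow2_abs x) as Ex;
  pose proof (pow2_ge_0 (1 - Rabs x)); pose proof (Rabs_pos (f x)); rewrite <- Ex.
- assert (1 + Rabs x <= 2 * (1 + Rabs x ^ 2)) by nra.
  apply Rle_trans with (c * (2 * (1 + Rabs x ^ 2))).
  + eapply Rle_trans; [apply Hlin|]; now apply Rmult_le_compat_l.
  + pose proof (pow2_ge_0 c); nra.
- rewrite (Rabs_pos_eq (f x ^ 2)) by apply pow2_ge_0; rewrite <- (pow2_abs (f x)).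
  apply Rle_trans with ((c * (1 + Rabs x)) ^ 2); [apply pow_incr; lra|].
  replace ((c * (1 + Rabs x)) ^ 2) with (c ^ 2 * (1 + Rabs x) ^ 2) by ring.
  assert ((1 + Rabs x) ^ 2 <= 2 * (1 + Rabs x ^ 2)) by nra.
  apply Rle_trans with (c ^ 2 * (2 * (1 + Rabs x ^ 2))).
  + apply Rmult_le_compat_l; [apply pow2_ge_0|easy].
  + nra.
Qed.

(** * The inequality *)

Lemma expect_GSY_ext (eps : R) (f g : R -> R -> R -> R) (L : R) :
  (forall x s y, f x s y = g x s y) -> expect_GSY eps f L -> expect_GSY eps g L.
Proof.
intros E [k [Hin Hout]]; exists k; split; auto.
intros s; apply (improper_int_ext _ _ _) with (2 := Hin s); intros x; now rewrite !E.
Qed.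

Theorem theorem2
  (l : R -> R) (eps delta : R)
  (Menv Mp : R -> R -> R) (mu alpha lam : R) :
  convex_fun l ->
  cont_diff l ->
  0 <= eps <= 1 / 2 ->
  1 < delta ->
  (* Menv x lam = M_l(x;lam), Mp x lam = its derivative in x *)
  (forall lm x, 0 < lm -> is_moreau l lm x (Menv x lm)) ->
  (forall lm x, 0 < lm -> derivable_pt_lim (fun z => Menv z lm) x (Mp x lm)) ->
  (* (mu, alpha, lam) is the unique solution of the system, mu <> 0 *)
  0 < alpha -> 0 < lam ->
  system eps delta Mp mu alpha lam ->
  (forall mu' alpha' lam', 0 < alpha' -> 0 < lam' ->
     system eps delta Mp mu' alpha' lam' ->
     mu' = mu /\ alpha' = alpha /\ lam' = lam) ->
  mu <> 0 ->
  forall p dp : R -> R,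
    is_density_H eps (alpha / mu) p ->
    (forall h, derivable_pt_lim p h (dp h)) ->
    exists I, fisher_info p dp I /\ (alpha / mu) ^ 2 * I >= 1 / delta.
Proof.
intros Hl _ Heps Hdelta HM HMp Halpha Hlam [_ [[E2 [HE2 E2eq]] [E3 [HE3 E3eq]]]] _ Hmu
  p dp Hp Hdp.
set (sig := alpha / mu) in *.
assert (Hs : sig <> 0) by (apply Rmult_integral_contrapositive_currified;
  [lra|now apply Rinv_neq_0_compat]).
assert (He : 0 <= eps <= 1) by lra.
set (f := fun h => Mp (mu * h) lam).
assert (HLip : forall x y, Rabs (f y - f x) <= 2 / lam * Rabs mu * Rabs (y - x)).
{ intros x y; rewrite Rmult_assoc, <- Rabs_mult, Rmult_minus_distr_l.
  apply (moreau_deriv_Lipschitz l (fun z => Menv z lam) (fun z => Mp z lam)); auto. }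
assert (Hfc := Lipschitz_continuous f _ HLip).
destruct (Lipschitz_growth f _ HLip) as [B [HB1 HB2]].
assert (Hf2c : forall h, continuous (fun h => f h ^ 2) h).
{ intros h; apply (continuous_comp f (fun g => g ^ 2)); [apply Hfc|apply sqr_cont]. }
assert (Earg : forall g s y, alpha * g + mu * s * y = mu * (sig * g + s * y))
  by (intros; unfold sig; field; auto).
set (P := marg eps sig cst1); set (P1 := marg eps sig (fun g => g)).
assert (H2 : improper_int (fun h => f h ^ 2 * P h) E2).
{ apply (expect_marg eps sig cst1 (fun h => f h ^ 2) B E2 He Hs cst1_cont cst1_bound Hf2c HB2).
  revert HE2; apply expect_GSY_ext; intros; unfold cst1, f; rewrite Earg; ring. }
assert (H3 : improper_int (fun h => f h * P1 h) E3).
{ apply (expect_marg eps sig (fun g => g) f B E3 He Hs (fun g => continuous_id g)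
    id_bound Hfc HB1).
  revert HE3; apply expect_GSY_ext; intros; unfold f; now rewrite Earg. }
assert (Hpc : forall h, continuous p h).
{ intros h; apply (ex_derive_continuous (V := R_NormedModule)); exists (dp h).
  apply is_derive_Reals, Hdp. }
assert (Ep : forall h, p h = P h) by now apply density_marg.
assert (Edp : forall h, dp h = - / sig * P1 h).
{ intros h; transitivity (Derive p h).
  - symmetry; apply is_derive_unique, is_derive_Reals, Hdp.
  - rewrite (Derive_ext p P) by auto; now apply is_derive_unique, marg_derive. }
assert (Hpos : forall h, 0 < P h) by (intros; now apply marg_pos).
(* By [Ep] and [Edp] this is the Fisher integrand times [sig ^ 2]. *)
set (q := fun h => P1 h ^ 2 / P h).
assert (Hqc : forall h, continuous q h).
{ intros h; apply (continuous_mult (K := R_AbsRing)).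
  - apply (continuous_comp P1 (fun g => g ^ 2)); [|apply sqr_cont].
    apply marg_cont; auto; [intros; apply continuous_id|apply id_bound].
  - apply (continuous_comp P Rinv).
    + apply marg_cont; auto; [apply cst1_cont|apply cst1_bound].
    + apply (ex_derive_continuous (V := R_NormedModule)); auto_derive.
      specialize (Hpos h); lra. }
destruct (mix_dominated_1 eps sig (fun g => g ^ 2) He Hs sqr_bound) as [C HC].
assert (HJ : improper_int q (RInt_line q)).
{ apply dominated_RInt_line with (C * PI); auto; intros h.
  rewrite Rabs_pos_eq by (apply Rdiv_le_0_compat; [apply pow2_ge_0|auto]).
  apply (Rle_trans _ _ _ (marg_Cauchy_Schwarz eps sig h He Hs)).
  apply (Rle_trans _ _ _ (Rle_abs _)).
  apply (plane_RInt_line_bound (mix eps sig (fun g => g ^ 2))); auto; apply mix_cont2_1, sqr_cont. }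
set (J := RInt_line q) in *.
exists (/ sig ^ 2 * J); split.
{ unfold fisher_info; apply (improper_int_ext (fun h => / sig ^ 2 * q h));
    [|now apply improper_int_scal].
  intros h; unfold q; rewrite Ep, Edp; specialize (Hpos h); field; lra. }
replace (sig ^ 2 * (/ sig ^ 2 * J)) with J by (field; auto).
(* [c] minimises [E2 + 2 c E3 + c ^ 2 / delta]. *)
set (c := - (alpha / lam)).
(* Cauchy-Schwarz as one nonnegative quadratic: the integral of [P * (f + c * P1 / P) ^ 2],
   expanded. *)
assert (HQ := improper_int_lin _ _ _ _ 1 (c ^ 2)
  (improper_int_lin _ _ _ _ 1 (2 * c) H2 H3) HJ).
apply improper_int_ge0 in HQ.
(* With [r = alpha / lam] and [i = / delta], [HQ] becomes [r ^ 2 * i - 2 * r ^ 2 * i + r ^ 2 * J >=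
   0], and division by [r ^ 2] gives [J >= i]. *)
- assert (E2v : E2 = (alpha / lam) ^ 2 * / delta)
    by (transitivity (alpha ^ 2 / (lam ^ 2 * delta)); [rewrite <- E2eq|]; field; lra).
  assert (E3v : E3 = alpha / lam * / delta) by (rewrite <- E3eq; field; lra).
  assert (Hr : 0 < (alpha / lam) ^ 2) by (apply pow_lt, Rdiv_lt_0_compat; lra).
  rewrite E2v, E3v in HQ; unfold c in HQ.
  unfold Rdiv at 1; rewrite Rmult_1_l.
  set (r := alpha / lam) in *; set (i := / delta) in *.
  apply Rle_ge, (Rmult_le_reg_l (r ^ 2)); auto; lra.
- intros h.
  replace (_ + _) with (P h * (f h + c * P1 h / P h) ^ 2)
    by (unfold q; field; specialize (Hpos h); lra).
  apply Rmult_le_pos; [now left|apply pow2_ge_0].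
Qed.
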